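(* Let $k \ge 3$, let $\mathcal{M} \subset \mathbb{R}^n$ be a $C^k$ submanifold, and let $\mathscr{F}$ be a normal foliation of a neighborhood $D$ of $\mathcal{M}$, with canonical projection $\pi: D\to\mathcal{M}$ and induced retraction $R_{\mathscr{F}}(x,v) = \pi(x+v)$. Let $R_P$ be the projective retraction on $\mathcal{M}$. Then for every $x \in \mathcal{M}$ and $v \in T_x\mathcal{M}$, $$R_{\mathscr{F}}(x,v) = R_P(x,v) + o(\|v\|^3) \quad \text{as } v \to 0.$$
   Context: Normal foliation: a normal foliation $\mathscr{F}$ of a neighborhood $D$ of a codimension-$c$ submanifold $\mathcal{M}\subset\mathbb{R}^n$ is a partition $D = \bigsqcup_{p\in\mathcal{M}} \mathscr{F}_p$ into connected $c$-dimensional submanifolds (leaves), with $p \in \mathscr{F}_p$, which intersect $\mathcal{M}$ orthogonally: $T_p\mathscr{F}_p = (T_p\mathcal{M})^\perp$ for all $p \in \mathcal{M}$. The canonical projection $\pi : D \to \mathcal{M}$ is defined by $x \in \mathscr{F}_{\pi(x)}$; it is assumed to be of class $C^{k-1}$. The induced retraction is $R_{\mathscr{F}}(x,v) = \pi(x+v)$, defined on $\{(x,v)\in T\mathcal{M} : x+v\in D\}$. Projective retraction: $R_P(x,v) = P_{\mathcal{M}}(x+v)$, where $P_{\mathcal{M}}(y) = \arg\min\{\|z-y\| : z\in\mathcal{M}\}$; it is single-valued for $v$ small enough (given $x$). *)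

(* Defs.v *)
From mathcomp Require Import all_boot all_order all_algebra.
From mathcomp Require Import all_classical all_reals all_analysis.

Set Implicit Arguments.
Unset Strict Implicit.
Unset Printing Implicit Defensive.

Import Order.TTheory GRing.Theory Num.Theory.
Import numFieldNormedType.Exports.

Local Open Scope classical_set_scope.
Local Open Scope ring_scope.

(* The library's norm on 'rV[R]_n is the sup norm, hence a separate Euclidean
   norm; the topologies agree. *)
Definition dot (R : realType) (n : nat) (u v : 'rV[R]_n) : R :=
  \sum_i u 0 i * v 0 i.

Definition enorm (R : realType) (n : nat) (u : 'rV[R]_n) : R :=
  Num.sqrt (dot u u).

Definition orthogonal_complement (R : realType) (n : nat)
    (E : set 'rV[R]_n) : set 'rV[R]_n :=
  [set w | forall v, E v -> dot v w = 0].

(* Class C^k on U, meant for open U. In finite dimension, continuity of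
   x |-> 'D_v f x for every v amounts to continuity of the differential. *)
Fixpoint Ck (R : realType) (m p : nat) (k : nat) (U : set 'rV[R]_m)
    (f : 'rV[R]_m -> 'rV[R]_p) {struct k} : Prop :=
  match k with
  | 0 => forall x, U x -> {for x, continuous f}
  | k'.+1 => (forall x, U x -> differentiable f x) /\
             (forall v, Ck k' U ('D_v f))
  end.

(* phi is a C^k diffeomorphism from the open set U onto the open set V, with
   inverse psi; values outside U and V are irrelevant. *)
Definition Ck_diffeo (R : realType) (n k : nat) (U V : set 'rV[R]_n)
    (phi psi : 'rV[R]_n -> 'rV[R]_n) : Prop :=
  [/\ open U /\ open V,
      Ck k U phi /\ Ck k V psi,
      (forall x, U x -> V (phi x)) /\ (forall y, V y -> U (psi y)),
      (forall x, U x -> psi (phi x) = x) &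
      (forall y, V y -> phi (psi y) = y)].

(* Embedded C^k submanifold of R^n of dimension d (for d <= n), given by slice
   charts: near each of its points, M is mapped onto an open part of
   R^d x {0}. *)
Definition submanifold (R : realType) (n k d : nat) (M : set 'rV[R]_n) : Prop :=
  forall p, M p -> exists (U V : set 'rV[R]_n) (phi psi : 'rV[R]_n -> 'rV[R]_n),
    [/\ U p, Ck_diffeo k U V phi psi &
        forall x, U x ->
          (M x <-> forall i : 'I_n, (d <= i)%N -> phi x 0 i = 0)].

(* Velocities at p of the curves drawn on M. *)
Definition tangent_space (R : realType) (n : nat) (M : set 'rV[R]_n)
    (p : 'rV[R]_n) : set 'rV[R]_n :=
  [set v | exists gamma : R -> 'rV[R]_n,
     [/\ gamma 0 = p, (\forall t \near (0 : R), M (gamma t)) &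
         is_derive (0 : R) 1 gamma v]].

(* D need not be open: it contains an open set containing M. The leaves are
   indexed by the points of M, and only required to be of class C^1. *)
Definition normal_foliation (R : realType) (n c : nat) (M D : set 'rV[R]_n)
    (F : 'rV[R]_n -> set 'rV[R]_n) : Prop :=
  [/\ M `<=` D°,
      partition M F D &
      forall p, M p ->
        [/\ F p p, connected (F p), submanifold 1 c (F p) &
            tangent_space (F p) p =
            orthogonal_complement (tangent_space M p)]].

(* For x in D, the unique p in M such that x lies on the leaf F p. *)
Definition canonical_projection (R : realType) (n : nat) (M : set 'rV[R]_n)
    (F : 'rV[R]_n -> set 'rV[R]_n) (x : 'rV[R]_n) : 'rV[R]_n :=
  [get p | M p /\ F p x].

Definition foliation_retraction (R : realType) (n : nat) (M : set 'rV[R]_n)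
    (F : 'rV[R]_n -> set 'rV[R]_n) (x v : 'rV[R]_n) : 'rV[R]_n :=
  canonical_projection M F (x + v).

Definition nearest_points (R : realType) (n : nat) (M : set 'rV[R]_n)
    (y : 'rV[R]_n) : set 'rV[R]_n :=
  [set z | M z /\ forall z', M z' -> enorm (z - y) <= enorm (z' - y)].

(* P_M y is the unique nearest point of y on M; if there is none, or more than
   one, it is an arbitrary default point. *)
Definition metric_projection (R : realType) (n : nat) (M : set 'rV[R]_n)
    (y : 'rV[R]_n) : 'rV[R]_n :=
  [get z | nearest_points M y = [set z]].

Definition projective_retraction (R : realType) (n : nat) (M : set 'rV[R]_n)
    (x v : 'rV[R]_n) : 'rV[R]_n :=
  metric_projection M (x + v).

(* Main.v *)
(** Idea. Write pi for the projection of the foliation. Differentiating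
    [pi \o gamma] along curves of M and of the leaves shows that at a point of M
    the differential of pi is the identity on tangent vectors and vanishes on
    normal ones. As pi is C^2, pi (x + v) = x + v + O(|v|^2), so that the nearest
    point q of y = x + v satisfies y - q = O(|v|^2). But y - q is normal to M
    at q, so that pi y = q + O(|y - q|^2) = q + O(|v|^4).

    The nearest point exists because M is locally closed, being locally the set
    of fixed points of pi. It is unique because the second-order expansion of pi
    at a point q of M bounds the component of q' - q along a normal vector w
    by O(|w| |q' - q|^2), for q' on M. *)
Require Import Defs.
From mathcomp Require Import all_boot all_order all_algebra.
From mathcomp Require Import all_classical all_reals all_analysis.
From mathcomp Require Import ring lra.

Set Implicit Arguments.
Unset Strict Implicit.
Unset Printing Implicit Defensive.

Import Order.TTheory GRing.Theory Num.Theory.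
Import numFieldNormedType.Exports.

Local Open Scope classical_set_scope.
Local Open Scope ring_scope.

(** * Sup norm, dot product and Euclidean norm *)

Lemma normr_coord (R : realType) n (u : 'rV[R]_n) i : `|u 0 i| <= `|u|.
Proof.
rewrite [leRHS]/Num.Def.normr /= mx_normrE; apply/bigmax_geP; right => /=.
by exists (0, i).
Qed.

Lemma normr_rV_le (R : realType) n (u : 'rV[R]_n) (a : R) :
  0 <= a -> (forall i, `|u 0 i| <= a) -> `|u| <= a.
Proof.
move=> a0 ua; rewrite [leLHS]/Num.Def.normr /= mx_normrE.
apply/bigmax_leP; split => //.
by move=> [i j] _ /=; rewrite (ord1 i).
Qed.

Lemma dotC (R : realType) n (u v : 'rV[R]_n) : dot u v = dot v u.
Proof. by apply: eq_bigr => i _; rewrite mulrC. Qed.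

Lemma dotBl (R : realType) n (u v w : 'rV[R]_n) :
  dot (u - v) w = dot u w - dot v w.
Proof.
by rewrite /dot -sumrB; apply: eq_bigr => i _; rewrite !mxE mulrBl.
Qed.

Lemma dotBr (R : realType) n (u v w : 'rV[R]_n) :
  dot u (v - w) = dot u v - dot u w.
Proof. by rewrite dotC dotBl !(dotC u). Qed.

Lemma dotNl (R : realType) n (u v : 'rV[R]_n) : dot (- u) v = - dot u v.
Proof. by rewrite -sumrN; apply: eq_bigr => i _; rewrite !mxE mulNr. Qed.

Lemma dot_ge0 (R : realType) n (u : 'rV[R]_n) : 0 <= dot u u.
Proof. by apply: sumr_ge0 => i _; rewrite -expr2 sqr_ge0. Qed.

Lemma normr_dot_le (R : realType) n (u v : 'rV[R]_n) :
  `|dot u v| <= n%:R * `|u| * `|v|.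
Proof.
apply: le_trans (ler_norm_sum _ _ _) _.
rewrite -mulrA mulr_natl -[X in _ *+ X]card_ord -sumr_const.
by apply: ler_sum => i _; rewrite normrM ler_pM// normr_coord.
Qed.

Lemma enorm_ge0 (R : realType) n (u : 'rV[R]_n) : 0 <= enorm u.
Proof. exact: sqrtr_ge0. Qed.

Lemma enorm_sqr (R : realType) n (u : 'rV[R]_n) : enorm u ^+ 2 = dot u u.
Proof. by rewrite sqr_sqrtr// dot_ge0. Qed.

Lemma enormN (R : realType) n (u : 'rV[R]_n) : enorm (- u) = enorm u.
Proof. by rewrite /enorm dotNl dotC dotNl opprK. Qed.

Lemma normr_le_enorm (R : realType) n (u : 'rV[R]_n) : `|u| <= enorm u.
Proof.
apply: normr_rV_le (enorm_ge0 _) _ => i.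
rewrite -(ler_pXn2r (ltn0Sn 1)) ?nnegrE ?enorm_ge0//.
rewrite enorm_sqr real_normK ?num_real// /dot (bigD1 i)//= -expr2 lerDl.
by apply: sumr_ge0 => j _; rewrite -expr2 sqr_ge0.
Qed.

(** The cruder [n.+1] replaces the square root of [n]: it avoids roots and stays positive for
    [n = 0]. *)
Lemma enorm_le_normr (R : realType) n (u : 'rV[R]_n) :
  enorm u <= n.+1%:R * `|u|.
Proof.
rewrite -(ler_pXn2r (ltn0Sn 1)) ?nnegrE ?enorm_ge0 ?mulr_ge0//.
rewrite enorm_sqr exprMn; apply: le_trans (ler_norm _) _.
apply: le_trans (normr_dot_le _ _) _; rewrite -mulrA -expr2 ler_wpM2r ?sqr_ge0//.
by rewrite -natrX ler_nat; apply: leq_trans (leqnSn n) _; rewrite expnS leq_pmulr.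
Qed.

(** * Derivatives along curves and segments *)

Lemma is_derive_comp_curve (R : realType) m p (f : 'rV[R]_m -> 'rV[R]_p)
    (gamma : R -> 'rV[R]_m) (t : R) v :
  is_derive t (1:R) gamma v -> differentiable f (gamma t) ->
  is_derive t (1:R) (f \o gamma) ('D_v f (gamma t)).
Proof.
move=> gv df.
have dg : differentiable gamma t by apply/derivable1_diffP; case: gv.
have dfg : differentiable (f \o gamma) t by exact: differentiable_comp.
apply: DeriveDef; first exact: diff_derivable.
by rewrite !deriveE// diff_comp//= -(deriveE _ dg) derive_val.
Qed.

Lemma is_derive_segment (R : realType) m (a h : 'rV[R]_m) (t : R) :
  is_derive t (1:R) (fun s => a + s *: h) h.
Proof.
have dl : is_diff t (fun s : R => a + s *: h) (0 + (fun s : R => s *: h)).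
  exact: (is_diffD (is_diff_cst _ _) (is_diff_scalel _ _)).
apply: DeriveDef; first exact: diff_derivable.
by rewrite deriveE// diff_val/= fctE add0r scale1r.
Qed.

Lemma is_derive_coord (R : realType) m (gamma : R -> 'rV[R]_m) (t : R) v i :
  is_derive t (1:R) gamma v -> is_derive t (1:R) (fun s => gamma s 0 i) (v 0 i).
Proof.
move=> [dg <-]; apply: DeriveDef; first by move/derivable_mxP : (dg); apply.
by rewrite derive_mx// mxE.
Qed.

(** The mean value equality fails for vector-valued maps, so it is used coordinate by coordinate;
    [t] depends on [i]. *)
Lemma mean_value_coord (R : realType) m p (f : 'rV[R]_m -> 'rV[R]_p)
    (a h : 'rV[R]_m) i :
  (forall t : R, 0 <= t <= 1 -> differentiable f (a + t *: h)) ->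
  exists2 t : R, 0 <= t <= 1 &
    (f (a + h) - f a) 0 i = ('D_h f (a + t *: h)) 0 i.
Proof.
move=> df.
pose g (t : R) : R := f (a + t *: h) 0 i.
have dg (t : R) : 0 <= t <= 1 -> is_derive t (1:R) g ('D_h f (a + t *: h) 0 i).
  move=> t01; apply: (@is_derive_coord _ _ (f \o (fun s => a + s *: h))).
  apply: is_derive_comp_curve; first exact: is_derive_segment.
  exact: df.
have [|||t t01] := @MVT R g (fun t => 'D_h f (a + t *: h) 0 i) 0 1.
- exact: ltr01.
- by move=> t /[!in_itv]/= /andP[t0 t1]; apply: dg; rewrite !ltW.
- apply: derivable_within_continuous => t /[!in_itv]/= t01.
  by case: (dg t t01).
- rewrite subr0 mulr1 /g scale1r scale0r addr0 => gE.
  exists t; last by rewrite !mxE.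
  by move: t01; rewrite in_itv/= => /andP[t0 t1]; rewrite !ltW.
Qed.

(** [Ck] controls one direction at a time; bounds uniform in the direction come from the finitely
    many basis vectors. *)
Lemma derive_expand (R : realType) m p (f : 'rV[R]_m -> 'rV[R]_p) a v :
  differentiable f a -> 'D_v f a = \sum_j v 0 j *: 'D_(delta_mx 0 j) f a.
Proof.
move=> df; rewrite deriveE// {1}[v]row_sum_delta linear_sum.
by apply: eq_bigr => j _; rewrite linearZ/= deriveE.
Qed.

Lemma ball_segment (R : realType) m (x y z : 'rV[R]_m) (r t : R) :
  ball x r y -> ball x r z -> 0 <= t <= 1 -> ball x r (y + t *: (z - y)).
Proof.
rewrite -!ball_normE /= => xy xz /andP[t0 t1].
have -> : x - (y + t *: (z - y)) = (1 - t) *: (x - y) + t *: (x - z).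
  apply/rowP => i; rewrite !mxE; ring.
apply: le_lt_trans (ler_normD _ _) _.
rewrite !normrZ ger0_norm ?subr_ge0// ger0_norm//.
(* Strictness comes from the term with factor [t], which must then be nonzero. *)
have [->|tn0] := eqVneq t 0; first by rewrite subr0 mul1r mul0r addr0.
have -> : r = (1 - t) * r + t * r by ring.
apply: ler_ltD; first by rewrite ler_wpM2l ?subr_ge0// ltW.
by rewrite ltr_pM2l// lt_neqAle eq_sym tn0.
Qed.

(** * Local Lipschitz and Taylor estimates *)

(** Partial derivatives are bounded near [x] by continuity, and the mean value theorem on segments
    concludes. [K] serves all small radii, so several such estimates can share a ball. *)
Lemma Ck1_lipschitz (R : realType) m p (U : set 'rV[R]_m)
    (f : 'rV[R]_m -> 'rV[R]_p) x :
  open U -> U x -> Ck 1 U f ->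
  exists2 K : R, 0 <= K & \forall r \near 0^'+,
    forall y z, ball x r y -> ball x r z -> `|f z - f y| <= K * `|z - y|.
Proof.
move=> oU Ux [df cf].
(* The margin 1 turns bounds at [x] into bounds on a neighborhood. *)
pose K := \sum_(j < m) (`|'D_(delta_mx 0 j) f x| + 1).
have K0 : 0 <= K by apply: sumr_ge0 => j _; rewrite addr_ge0.
exists K => //.
have : \forall y \near x, U y /\
    forall j, `|'D_(delta_mx 0 j) f y| <= `|'D_(delta_mx 0 j) f x| + 1.
  near=> y; split; first by near: y; exact: open_nbhs_nbhs.
  near: y; apply: filter_forall => j.
  have /cvgrPdist_lt/(_ 1 ltr01) := cf (delta_mx 0 j) x Ux.
  apply: filterS => y /ltW xy.
  rewrite -lerBlDl; apply: le_trans (lerB_dist _ _) _.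
  by rewrite distrC.
move=> /nbhs_ballP[e /= e0 H].
near=> r => y z xy xz.
have sub w : ball x r w -> ball x e w.
  by apply: le_ball; near: r; exact: nbhs_right_le.
apply: normr_rV_le => [|i]; first by rewrite mulr_ge0.
have seg (t : R) : 0 <= t <= 1 -> ball x e (y + t *: (z - y)).
  by move=> t01; apply: sub; exact: ball_segment.
have [t t01|t t01] := @mean_value_coord _ _ _ f y (z - y) i.
  by apply: df; case: (H _ (seg _ t01)).
rewrite [y + (z - y)]addrC subrK => E.
have [Ut Ht] := H _ (seg _ t01).
rewrite [X in Num.norm X]E.
rewrite derive_expand; last exact: df.
apply: le_trans (normr_coord _ _) _; apply: le_trans (ler_norm_sum _ _ _) _.
rewrite mulr_suml; apply: ler_sum => j _.
by rewrite normrZ mulrC ler_pM// normr_coord.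
Unshelve. all: by end_near. Qed.

Lemma CkS_Ck (R : realType) m p k (U : set 'rV[R]_m)
  (f : 'rV[R]_m -> 'rV[R]_p) : Ck k.+1 U f -> Ck k U f.
Proof.
elim: k f => [|k IH] f; first by case=> df _ x /df/differentiable_continuous.
by case=> df cf; split => // v; exact: IH.
Qed.

Lemma Ck_le (R : realType) m p j k (U : set 'rV[R]_m)
  (f : 'rV[R]_m -> 'rV[R]_p) : (j <= k)%N -> Ck k U f -> Ck j U f.
Proof.
move=> /subnKC <-; elim: (k - j)%N => [|i IH]; first by rewrite addn0.
by rewrite addnS => /CkS_Ck.
Qed.

(** By the mean value theorem the remainder is an increment of the differential applied to [z - y],
    and the partial derivatives are Lipschitz. The base point [y] varies in the ball: the expansion
    is needed at [x] and at points of M near it. *)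
Lemma Ck2_taylor (R : realType) m p (U : set 'rV[R]_m)
    (f : 'rV[R]_m -> 'rV[R]_p) x :
  open U -> U x -> Ck 2 U f ->
  exists2 K : R, 0 <= K & \forall r \near 0^'+,
    forall y z, ball x r y -> ball x r z ->
    `|f z - f y - 'D_(z - y) f y| <= K * `|z - y| ^+ 2.
Proof.
move=> oU Ux [df cf].
have /choice[k Hk] : forall j, exists K : R, 0 <= K /\
    \forall r \near 0^'+, forall y z, ball x r y -> ball x r z ->
     `|'D_(delta_mx 0 j) f z - 'D_(delta_mx 0 j) f y| <= K * `|z - y|.
  move=> j; have [K K0 HK] := Ck1_lipschitz oU Ux (cf (delta_mx 0 j)).
  by exists K.
pose K := \sum_(j < m) k j.
exists K; first by apply: sumr_ge0 => j _; case: (Hk j).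
have /nbhs_ballP[e /= e0 H] : nbhs x U by exact: open_nbhs_nbhs.
have lip : \forall r \near 0^'+, forall j y z, ball x r y -> ball x r z ->
     `|'D_(delta_mx 0 j) f z - 'D_(delta_mx 0 j) f y| <= k j * `|z - y|.
  by apply: filter_forall => j; case: (Hk j).
apply: filterS2 lip (nbhs_right_le e0) => r lip re y z xy xz.
have sub w : ball x r w -> U w by move=> xw; apply: H; exact: le_ball xw.
apply: normr_rV_le => [|i].
  by rewrite mulr_ge0 ?sqr_ge0//; apply: sumr_ge0 => j _; case: (Hk j).
have seg (t : R) : 0 <= t <= 1 -> ball x r (y + t *: (z - y)).
  by move=> t01; exact: ball_segment.
have [t t01|t t01] := @mean_value_coord _ _ _ f y (z - y) i.
  by apply: df; apply: sub; exact: seg.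
rewrite [y + (z - y)]addrC subrK => E.
rewrite mxE E !derive_expand; [|by apply/df/sub|by apply/df/sub/seg].
set v := z - y.
rewrite !summxE mxE summxE -sumrB.
apply: le_trans (ler_norm_sum _ _ _) _.
rewrite mulr_suml; apply: ler_sum => j _.
rewrite !mxE -mulrBr normrM expr2 mulrA mulrC ler_pM// ?normr_coord//.
have := normr_coord ('D_(delta_mx 0 j) f (y + t *: v) - 'D_(delta_mx 0 j) f y) i.
rewrite !mxE => /le_trans; apply.
have /le_trans := lip j y (y + t *: v) xy (seg _ t01); apply.
rewrite [y + _]addrC addrK normrZ ler_wpM2l ?(Hk j).1//.
by move/andP: t01 => [t0 t1]; rewrite ger0_norm// ler_piMl.
by have := normr_coord v j; rewrite !mxE.
Qed.

(** * Nearest points: orthogonality, existence, uniqueness *)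

(** Difference quotients are nonpositive on the left of [c] and nonnegative on the right. *)
Lemma is_derive_local_min (R : realType) (f : R -> R) (c l : R) :
  is_derive c (1:R) f l -> (\forall t \near c, f c <= f t) -> l = 0.
Proof.
move=> [df <-] cmin.
have fcvg : h^-1 *: ((f \o shift c) (h *: (1:R)) - f c) @[h --> 0^'] -->
    'D_1 f c by exact: df.
have near0 : \forall h \near (0:R), f c <= f (h *: (1:R) + c).
  have : (h *: (1:R) + c) @[h --> (0:R)] --> c.
    rewrite -[X in _ --> X]add0r -[X in _ --> X + _](scale0r (1:R)).
    by apply: cvgD; [apply: cvgZr_tmp; exact: cvg_id|exact: cvg_cst].
  by move=> /(_ _ cmin).
apply/eqP; rewrite eq_le; apply/andP; split.
- have fl := cvg_dnbhs_at_left fcvg.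
  rewrite -(cvg_lim _ fl)//; apply: limr_le.
    by apply/cvg_ex; eexists; exact: fl.
  near=> h; rewrite /= [_ *: _]mulrC; apply: mulr_ge0_le0.
    by rewrite subr_ge0; near: h; exact: cvg_within near0.
  by rewrite invr_le0 ltW.
- have fl := cvg_dnbhs_at_right fcvg.
  rewrite -(cvg_lim _ fl)//; apply: limr_ge.
    by apply/cvg_ex; eexists; exact: fl.
  near=> h; rewrite /= [_ *: _]mulrC; apply: mulr_ge0.
    by rewrite subr_ge0; near: h; exact: cvg_within near0.
  by rewrite invr_ge0 ltW.
Unshelve. all: by end_near. Qed.

(** Along a curve of M through [q] with velocity [v], the squared distance to [y] is minimal at time
    0, where its derivative is twice [dot (q - y) v]. *)
Lemma nearest_point_normal (R : realType) n (M : set 'rV[R]_n) y q v :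
  nearest_points M y q -> tangent_space M q v -> dot v (y - q) = 0.
Proof.
move=> [Mq qmin] [gamma [g0 gM gv]].
have d1 i : is_derive (0:R) (1:R) (fun s => gamma s 0 i - y 0 i) (v 0 i).
  rewrite -[v 0 i]subr0; apply: is_deriveB; exact: is_derive_coord.
have dd : is_derive (0:R) (1:R) (fun s => dot (gamma s - y) (gamma s - y))
    (\sum_i ((gamma 0 - y) 0 i *: v 0 i + (gamma 0 - y) 0 i *: v 0 i)).
  have -> : (fun s => dot (gamma s - y) (gamma s - y)) =
      \sum_i ((fun s => gamma s 0 i - y 0 i) * (fun s => gamma s 0 i - y 0 i)).
    apply/funext => s; rewrite fct_sumE; apply: eq_bigr => i _.
    by rewrite !mxE.
  apply: is_derive_sum => i.
  by rewrite !mxE; exact: (is_deriveM (d1 i) (d1 i)).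
have : \forall t \near 0, dot (gamma 0 - y) (gamma 0 - y) <=
    dot (gamma t - y) (gamma t - y).
  near=> t; rewrite g0 -!enorm_sqr ler_pXn2r ?nnegrE ?enorm_ge0//.
  by apply: qmin; near: t.
move=> /(is_derive_local_min dd)/eqP.
rewrite g0 big_split/= -mulr2n mulrn_eq0/= => /eqP H.
by rewrite -opprB dotC dotNl [dot _ _]H oppr0.
Unshelve. all: by end_near. Qed.

(** The distance to [y] attains its minimum on the compact part of M in the ball. By the triangle
    inequality, points of M outside the ball are farther from [y] than [x] is. *)
Lemma nearest_points_nonempty (R : realType) n (M : set 'rV[R]_n) x y (r : R) :
  0 < r -> M x -> closed (M `&` closed_ball x r) -> 2 * enorm (x - y) <= r ->
  nearest_points M y !=set0.
Proof.
move=> r0 Mx clM xyr.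
pose A := M `&` closed_ball x r.
have Ax : A x by split => //; exact: closed_ballxx.
have cA : compact A.
  apply: bounded_closed_compact => //.
  exists (`|x| + r); split; first exact: num_real.
  move=> a ra z [_]; rewrite closed_ballE//= /closed_ball_/= => xz.
  apply: le_trans (ltW ra).
  rewrite -lerBlDl; apply: le_trans (lerB_dist _ _) _.
  by rewrite distrC.
have cd : continuous (fun z : 'rV[R]_n => dot (z - y) (z - y)).
  move=> z; apply: differentiable_continuous.
  have -> : (fun z : 'rV[R]_n => dot (z - y) (z - y)) =
      \sum_i ((fun z : 'rV[R]_n => z 0 i - y 0 i) *
        (fun z : 'rV[R]_n => z 0 i - y 0 i)).
    apply/funext => s; rewrite fct_sumE; apply: eq_bigr => i _.
    by rewrite !mxE.
  apply: differentiable_sum => i; apply: differentiableM;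
    apply: differentiableB => //; exact: differentiable_coord.
have [|q /set_mem[Mq _] qmin] := EVT_min_rV (ex_intro _ x Ax) cA
  (f := fun z : 'rV[R]_n => dot (z - y) (z - y)).
  exact: continuous_subspaceT.
have {}qmin z : A z -> enorm (q - y) <= enorm (z - y).
  by move=> Az; apply: ler_wsqrtr; apply: qmin; exact: mem_set.
exists q; split => // z Mz.
have [xz|xz] := leP `|x - z| r.
  by apply: qmin; split => //; rewrite closed_ballE.
apply: le_trans (qmin x Ax) _; apply: le_trans (normr_le_enorm _).
have := ler_distD y x z; have := normr_le_enorm (x - y).
rewrite (distrC y z); lra.
Qed.

(* By symmetry it suffices to bound <q' - q, y - q>; there the first-order part
   of pi q' - pi q = q' - q is tangent, hence orthogonal to y - q. *)
Lemma nearest_points_unique (R : realType) n (M B : set 'rV[R]_n)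
    (pi : 'rV[R]_n -> 'rV[R]_n) (K : R) y q1 q2 :
  (forall q, M q -> pi q = q) ->
  (forall q u, M q -> B q -> tangent_space M q ('D_u pi q)) ->
  (forall p z, B p -> B z ->
    `|pi z - pi p - 'D_(z - p) pi p| <= K * `|z - p| ^+ 2) ->
  nearest_points M y q1 -> nearest_points M y q2 -> B q1 -> B q2 ->
  2 * (n%:R * K * enorm (q1 - y)) < 1 -> q1 = q2.
Proof.
move=> piM Tpi taylor n1 n2 B1 B2 small.
have e12 : enorm (q2 - y) = enorm (q1 - y).
  apply/eqP; rewrite eq_le; case: n1 n2 => M1 m1 [M2 m2].
  by rewrite m1// m2.
have main q q' : nearest_points M y q -> nearest_points M y q' -> B q -> B q' ->
    `|dot (q' - q) (y - q)| <= n%:R * K * enorm (q - y) * `|q' - q| ^+ 2.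
  move=> nq nq' Bq Bq'.
  have Mq := nq.1; have Mq' := nq'.1.
  have := nearest_point_normal nq (Tpi q (q' - q) Mq Bq) => D0.
  have T := taylor q q' Bq Bq'; rewrite !piM// in T.
  rewrite -[dot _ _]subr0 -[X in _ - X]D0 -dotBl.
  apply: le_trans (normr_dot_le _ _) _.
  have E : `|y - q| <= enorm (q - y) by rewrite distrC normr_le_enorm.
  rewrite -!mulrA ler_wpM2l//.
  rewrite [enorm _ * _]mulrC mulrA.
  by apply: ler_pM.
have H1 := main _ _ n1 n2 B1 B2.
have H2 := main _ _ n2 n1 B2 B1.
rewrite e12 (distrC q1) in H2.
(* Both terms on the right are bounded by [main]. If [q1] and [q2] differ, dividing by the square of
   [|q2 - q1|] contradicts [small]. *)
have D : dot (q2 - q1) (q2 - q1) = dot (q2 - q1) (y - q1) + dot (q1 - q2) (y - q2).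
  rewrite -(opprB q2 q1) dotNl -dotBr; congr dot.
  by apply/rowP => i; rewrite !mxE; ring.
have N : `|q2 - q1| ^+ 2 <= dot (q2 - q1) (q2 - q1).
  by rewrite -enorm_sqr ler_pXn2r ?nnegrE ?enorm_ge0// normr_le_enorm.
have [h0|h0] := eqVneq `|q2 - q1| 0.
  by apply/eqP; rewrite eq_sym -subr_eq0 -normr_eq0 h0.
have hp : 0 < `|q2 - q1| ^+ 2 by rewrite exprn_gt0// lt_def h0 normr_ge0.
exfalso.
rewrite D in N; move: H1 H2 => /ler_normlP[_ H1] /ler_normlP[_ H2].
have : `|q2 - q1| ^+ 2 <= 2 * (n%:R * K * enorm (q1 - y)) * `|q2 - q1| ^+ 2.
  by lra.
by rewrite -[X in X <= _]mul1r ler_pM2r// leNgt small.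
Qed.

(** Every smallness condition imposed on [v] in the final estimate has this form. *)
Lemma mul_norm_lt_near0 (R : realFieldType) (V : normedModType R) (a b : R) :
  0 < b -> \forall v \near (0 : V), a * `|v| < b.
Proof.
move=> b0; apply: (@cvgr_lt _ _ (nbhs (0 : V)) _ (fun v => a * `|v|) 0) => //.
rewrite -[X in _ --> X](mulr0 a); apply: cvgMr.
by rewrite -[X in _ --> X](@normr0 _ V); exact: norm_continuous.
Qed.

(** * The projection of a foliation and its differential *)

(** The leaves are disjoint, so [get] has a single possible value. *)
Lemma canonical_projectionE (R : realType) (n c : nat) (M D : set 'rV[R]_n)
    (F : 'rV[R]_n -> set 'rV[R]_n) p y :
  normal_foliation c M D F -> M p -> F p y -> canonical_projection M F y = p.
Proof.
move=> [_ [_ /trivIsetP tF _] _] Mp Fpy.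
have [Mq Fqy] : [set p | M p /\ F p y] (canonical_projection M F y).
  by apply: getPex; exists p.
apply/eqP/negP => /negP qp.
by have : set0 y by rewrite -(tF _ _ Mq Mp qp).
Qed.

Lemma canonical_projection_id (R : realType) (n c : nat) (M D : set 'rV[R]_n)
    (F : 'rV[R]_n -> set 'rV[R]_n) p :
  normal_foliation c M D F -> M p -> canonical_projection M F p = p.
Proof.
move=> hF Mp; apply: (canonical_projectionE hF Mp).
by case: hF => _ _ /(_ _ Mp)[].
Qed.

Lemma canonical_projection_in (R : realType) (n c : nat) (M D : set 'rV[R]_n)
    (F : 'rV[R]_n -> set 'rV[R]_n) y :
  normal_foliation c M D F -> D y -> M (canonical_projection M F y).
Proof.
move=> hF; have [_ [<- _ _] _] := hF.
by move=> [p Mp Fpy]; rewrite (canonical_projectionE hF Mp Fpy).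
Qed.

(** [f] and [g] agree along a curve of S with velocity [v]. It serves with [g] the identity on M,
    and with [g] constant on a leaf. *)
Lemma derive_along_tangent (R : realType) n (f : 'rV[R]_n -> 'rV[R]_n)
    (S : set 'rV[R]_n) (g : 'rV[R]_n -> 'rV[R]_n) p v :
  {in S, f =1 g} -> differentiable f p -> differentiable g p ->
  tangent_space S p v -> 'D_v f p = 'D_v g p.
Proof.
move=> fg df dg [gamma [g0 gS gv]].
have fv : is_derive (0:R) (1:R) (f \o gamma) ('D_v f p).
  by rewrite -g0; apply: is_derive_comp_curve; rewrite // g0.
have gv' : is_derive (0:R) (1:R) (g \o gamma) ('D_v g p).
  by rewrite -g0; apply: is_derive_comp_curve; rewrite // g0.
rewrite -[LHS](@derive_val _ _ _ _ _ _ _ fv) -[RHS](@derive_val _ _ _ _ _ _ _ gv').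
apply: near_eq_derive; near=> t; apply: fg; apply: mem_set; near: t; exact: gS.
Unshelve. all: by end_near. Qed.

(** The curve realizing the velocity is the image under [f] of the line through [p] directed by
    [v]. *)
Lemma tangent_derive (R : realType) n (f : 'rV[R]_n -> 'rV[R]_n)
    (M : set 'rV[R]_n) p v :
  differentiable f p -> (\forall y \near p, M (f y)) ->
  tangent_space M (f p) ('D_v f p).
Proof.
move=> df Mf.
have sv := is_derive_segment p v 0.
exists (f \o (fun s : R => p + s *: v)); split.
- by rewrite /= scale0r addr0.
- have : {for (0:R), continuous (fun s : R => p + s *: v)}.
    by apply/differentiable_continuous/derivable1_diffP; case: sv.
  by rewrite /prop_for /continuous_at scale0r addr0 => /(_ _ Mf).
- have -> : 'D_v f p = 'D_v f (p + (0:R) *: v) by rewrite scale0r addr0.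
  by apply: is_derive_comp_curve => //; rewrite scale0r addr0.
Qed.

(** If a limit point [z] were moved by [f], then by continuity so would be all points near [z]. *)
Lemma closed_fixed_points (R : realType) n (f : 'rV[R]_n -> 'rV[R]_n)
    (A : set 'rV[R]_n) :
  closed A -> (forall z, A z -> {for z, continuous f}) ->
  closed ([set z | f z = z] `&` A).
Proof.
move=> clA cf z clz.
have Az : A z by apply: clA => B /clz[w [[_ Aw] Bw]]; exists w.
split => //=; apply/eqP/negP => /negP fz.
have : \forall w \near z, f w - w != 0.
  apply: (@cvgr_neq0 _ _ _ (nbhs z) _ (fun w => f w - w) (f z - z)).
    by apply: cvgB; [exact: (cf z Az)|exact: cvg_id].
  by rewrite subr_eq0.
by move=> /clz[w [[/= fw _]]]; rewrite fw subrr eqxx.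
Qed.

(** * Comparison of the two retractions *)

Theorem lemma2p8 (R : realType) (n c k : nat) (hk : (3 <= k)%N)
    (hc : (c <= n)%N) (M D : set 'rV[R]_n) (F : 'rV[R]_n -> set 'rV[R]_n)
    (hM : submanifold k (n - c) M)
    (hF : normal_foliation c M D F)
    (hpi : Ck k.-1 D° (canonical_projection M F))
    (x : 'rV[R]_n) (hx : M x) :
  foliation_retraction M F x =
  projective_retraction M x
    +o_ (within (tangent_space M x) (nbhs (0 : 'rV[R]_n)))
      (fun v : 'rV[R]_n => enorm v ^+ 3).
Proof.
pose pi := canonical_projection M F.
have [MD _ leaves] := hF.
have C2 : Ck 2 D° pi.
  by apply: Ck_le hpi; case: k hk {hM} => [|[|[|k]]].
have Dx : D° x := MD _ hx.
have piM q : M q -> pi q = q by exact: canonical_projection_id hF.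
have dpi q : D° q -> differentiable pi q by case: C2 => + _; exact.
have tangent_pi q u : M q -> tangent_space M q ('D_u pi q).
  (* The curve t |-> pi (q + t u) is drawn on M. *)
  move=> Mq; rewrite -{1}[q]piM//; apply: tangent_derive; first exact/dpi/MD.
  by apply: filterS (MD _ Mq) => y; exact: canonical_projection_in hF.
have Dpi_tangent q v : M q -> tangent_space M q v -> 'D_v pi q = v.
  move=> Mq Tv; rewrite -[RHS](derive_id q v).
  apply: (derive_along_tangent _ _ _ Tv); first by move=> y /set_mem/piM.
    exact/dpi/MD.
  exact: ex_diff.
(* The normal vector [y - q] is tangent to the leaf of [q], on which [pi] is constant. *)
have Dpi_normal q y : nearest_points M y q -> 'D_(y - q) pi q = 0.
  move=> nq; have Mq := nq.1; have [_ _ _ Tq] := leaves q Mq.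
  have : tangent_space (F q) q (y - q).
    by rewrite Tq => v Tv; exact: nearest_point_normal nq Tv.
  rewrite -[RHS](derive_cst q q (y - q)) => Tv.
  apply: (derive_along_tangent _ _ _ Tv).
    by move=> z /set_mem; exact: canonical_projectionE hF Mq.
    exact/dpi/MD.
  exact: ex_diff.
have [K K0 taylor_near] := Ck2_taylor (@open_interior _ D) Dx C2.
have /nbhs_closedballP[r1 r1D] : nbhs x D°.
  by apply: open_nbhs_nbhs; split => //; exact: open_interior.
have [r [r0 rD taylor]] : exists r, [/\ 0 < r, closed_ball x r `<=` D° &
    forall p z, ball x r p -> ball x r z ->
    `|pi z - pi p - 'D_(z - p) pi p| <= K * `|z - p| ^+ 2].
  near (0:R)^'+ => r; exists r; split; first by [].
    apply: subset_trans r1D; apply: le_closed_ball; near: r.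
    exact: nbhs_right_le.
  by near: r.
have clM : closed (M `&` closed_ball x r).
  rewrite (_ : _ `&` _ = [set z | pi z = z] `&` closed_ball x r); last first.
    apply/seteqP; split => z [H xz]; split => //; first exact: piM.
    rewrite -H; apply: (canonical_projection_in hF).
    by apply: interior_subset; exact: rD.
  apply: closed_fixed_points; first exact: closed_ball_closed.
  by move=> z /rD/dpi/differentiable_continuous.
(* [s] compares the Euclidean norm with the sup norm of the Taylor estimate. *)
pose s : R := n.+1%:R.
have s1 : 1 <= s by rewrite ler1n.
have s0 : 0 < s by rewrite ltr0n.
apply/eqaddoP => eps eps0.
near=> v.
have Tv : tangent_space M x v by near: v; exact: withinT.
(* [vr] keeps [y] and its nearest points in the ball, [vK] makes the nearest point unique, and [ve]
   absorbs the final constant into [eps]. *)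
have vr : 2 * s * `|v| < r.
  by near: v; apply: cvg_within; exact: (@mul_norm_lt_near0 R 'rV[R]_n).
have vK : 2 * (n%:R * K * s) * `|v| < 1.
  by near: v; apply: cvg_within; exact: (@mul_norm_lt_near0 R 'rV[R]_n).
have ve : K ^+ 3 * s ^+ 2 * `|v| <= eps.
  by apply: ltW; near: v; apply: cvg_within; exact: (@mul_norm_lt_near0 R 'rV[R]_n).
set y := x + v.
have xyE : x - y = - v by rewrite /y opprD addrA subrr sub0r.
have xy : enorm (x - y) = enorm v by rewrite xyE enormN.
have vs : enorm v <= s * `|v| := enorm_le_normr v.
have vle : `|v| <= s * `|v| by rewrite ler_peMl.
have [q nq] : nearest_points M y !=set0.
  apply: (nearest_points_nonempty r0 hx clM); rewrite xy; lra.
(* The point [x] of M is itself a competitor, at distance [enorm v] from [y]. *)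
have near_y q' : nearest_points M y q' -> enorm (q' - y) <= s * `|v|.
  by move=> [_ /(_ x hx)]; rewrite xy => /le_trans; apply.
have ball_q q' : nearest_points M y q' -> ball x r q'.
  move=> /near_y qy; rewrite -ball_normE /=.
  have := ler_distD y x q'; have := normr_le_enorm (q' - y).
  by rewrite (distrC q') xyE normrN; lra.
have PM : projective_retraction M x v = q.
  rewrite /projective_retraction -/y.
  have nE : nearest_points M y = [set q].
    apply/seteqP; split => [q' nq' /=|_ -> //].
    apply: (@nearest_points_unique _ _ M (ball x r) pi K y) => //.
    - by move=> p u Mp _; exact: tangent_pi.
    - exact: ball_q.
    - exact: ball_q.
    apply: le_lt_trans vK; rewrite -!mulrA ler_wpM2l// ler_wpM2l// ler_wpM2l//.
    exact: near_y.
  (* A singleton exists, so [get] does not return its default. *)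
  have : nearest_points M y = [set metric_projection M y].
    by apply: (getPex (P := fun z => nearest_points M y = [set z])); exists q.
  by rewrite nE => /seteqP[/(_ q erefl)/= qE _]; exact/esym.
have bx : ball x r x by exact: ballxx.
have bally : ball x r y by rewrite -ball_normE /= xyE normrN; lra.
(* As [v] is tangent, the first-order expansion of [pi] at [x] is [x + v], which is [y] itself. *)
have piy : `|pi y - y| <= K * `|v| ^+ 2.
  have := taylor x y bx bally.
  have yx : y - x = v by rewrite /y addrC addKr.
  by rewrite (piM x hx) yx Dpi_tangent// -addrA -opprD.
(* [pi y] lies on M, so [q] is at least as close to [y]. *)
have qy : `|y - q| <= s * (K * `|v| ^+ 2).
  rewrite distrC; apply: le_trans (normr_le_enorm _) _.
  apply: (@le_trans _ _ (enorm (pi y - y))).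
    apply: nq.2; apply: (canonical_projection_in hF).
    by apply: interior_subset; apply: rD; exact: subset_closed_ball.
  by apply: le_trans (enorm_le_normr _) _; rewrite ler_wpM2l// ltW.
(* Expanding at [q], where the first-order term vanishes, squares the bound [qy]: order four in
   [v]. *)
have piq : `|pi y - q| <= K * (s * (K * `|v| ^+ 2)) ^+ 2.
  have := taylor q y (ball_q q nq) bally; rewrite Dpi_normal// subr0 (piM q nq.1).
  move=> /le_trans; apply; rewrite ler_wpM2l// ler_pXn2r// nnegrE//.
  by rewrite !mulr_ge0// ?ltW// sqr_ge0.
rewrite /= !fctE PM -[foliation_retraction _ _ _ _]/(pi y).
apply: le_trans piq _.
rewrite ger0_norm ?exprn_ge0 ?enorm_ge0//.
(* One of the four factors [|v|] goes into [eps]. *)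
apply: (@le_trans _ _ (eps * `|v| ^+ 3)).
  rewrite [leLHS](_ : _ = K ^+ 3 * s ^+ 2 * `|v| * `|v| ^+ 3); last by ring.
  by rewrite ler_wpM2r// exprn_ge0.
rewrite (ler_wpM2l (ltW eps0))// ler_pXn2r// ?nnegrE ?enorm_ge0//.
exact: normr_le_enorm.
Unshelve. all: by end_near. Qed.
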